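(* Let $T$ be a continuous linear operator on a separable commutative $F$-algebra $X$ and let $d\ge1$. Assume that for any finite and non-empty $A\subset\mathbb N_0^d\setminus\{(0,\dots,0)\}$, for any non-empty open subsets $U_1,\dots,U_d,V$ of $X$ and for any neighbourhood $W$ of $0$, there exist $u=(u_1,\dots,u_d)\in U_1\times\cdots\times U_d$, $\beta\in A$ and $N\ge1$ such that $T^N(u^\beta)\in V$ and $T^N(u^\alpha)\in W$ for all $\alpha\in A$ with $\alpha\ne\beta$. Then the set of $d$-tuples that generate a hypercyclic algebra for $T$ is residual in $X^d$. Moreover, if the assumptions are satisfied for all $d\ge1$, then $T$ admits a hypercyclic algebra which is dense in $X$ and not finitely generated.
   Context: $\mathbb N_0=\{0,1,2,\dots\}$. An $F$-algebra is a metrizable and complete topological algebra over $\mathbb C$. For $u\in X^d$ and $\alpha\in\mathbb N_0^d\setminus\{0\}$, $u^\alpha=u_1^{\alpha_1}\cdots u_d^{\alpha_d}$ (factors with $\alpha_i=0$ are omitted; $X$ need not be unital). The algebra generated by $u\in X^d$ is $\{P(u):P\in\mathbb C[z_1,\dots,z_d],\ P(0)=0\}$. $HC(T)$ is the set of $x\in X$ whose orbit $\{x,Tx,T^2x,\dots\}$ is dense in $X$. A hypercyclic algebra for $T$ is a subalgebra of $X$, different from $\{0\}$ and not required to be unital, contained in $HC(T)\cup\{0\}$; finitely generated means generated, as a (non-unital) algebra, by finitely many elements. A set is residual if it contains a countable intersection of dense open sets. *)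

(* Defs.v *)
From HB Require Import structures.
From mathcomp Require Import all_boot all_order all_algebra.
From mathcomp Require Import complex finmap.
From mathcomp Require Import all_classical all_reals all_analysis.
From mathcomp Require Import borel_hierarchy.
From mathcomp Require Import -(notations) mpoly.

Set Implicit Arguments.
Unset Strict Implicit.
Unset Printing Implicit Defensive.

Import GRing.Theory.
Import numFieldNormedType.Exports.

Local Open Scope classical_set_scope.
Local Open Scope ring_scope.
Local Open Scope complex_scope.

Definition metrizable (R : realType) (M : topologicalType) : Prop :=
  exists d : M -> M -> R,
    [/\ forall x y, d x y = 0 <-> x = y,
        forall x y, d x y = d y x,
        forall x y z, d x z <= d x y + d y z
      & forall (x : M) (A : set M), nbhs x A <->
          exists2 e : R, 0 < e & [set y | d x y < e] `<=` A].

(* Completeness refers to the uniformity that the vector space topology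
   determines, independently of the choice of a compatible metric. *)
Definition tvs_cauchy (M : topologicalZmodType) (F : set_system M) : Prop :=
  forall U : set M, nbhs 0 U ->
    exists2 A, F A & forall x y, A x -> A y -> U (x - y).

(* MathComp's algebras are unital, hence a separate multiplication. *)
HB.mixin Record isTopologicalAlgebra (K : numDomainType) M
    & TopologicalLmodule K M := {
  amul : M -> M -> M ;
  amulA : associative amul ;
  amulDl : left_distributive amul +%R ;
  amulDr : right_distributive amul +%R ;
  amulZl : forall (k : K) (x y : M), amul (k *: x) y = k *: amul x y ;
  amulZr : forall (k : K) (x y : M), amul x (k *: y) = k *: amul x y ;
  amul_continuous : continuous (fun z : M * M => amul z.1 z.2)
}.

#[short(type="topologicalAlgType")]
HB.structure Definition TopologicalAlgebra (K : numDomainType) :=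
  {M of TopologicalLmodule K M & isTopologicalAlgebra K M}.

HB.mixin Record isFSpace (R : realType) M & TopologicalLmodule R[i] M := {
  metrizable_topology : metrizable R M ;
  tvs_cauchy_cvg : forall F : set_system M,
    ProperFilter F -> tvs_cauchy F -> exists x : M, F --> x
}.

#[short(type="fAlgebraType")]
HB.structure Definition FAlgebra (R : realType) :=
  {M of TopologicalAlgebra R[i] M & isFSpace R M}.

Section MonomialsAndPolynomials.
Context {R : realType} {X : fAlgebraType R} {d : nat}.
Implicit Types (u : 'I_d -> X) (S : set X).

(* The product of a nonempty word; 0 is a dummy value for the empty word. *)
Definition word_prod (s : seq X) : X :=
  if s is x :: s' then foldl amul x s' else 0.

(* u^alpha, for alpha != 0: the word repeats each letter u_i alpha_i times. *)
Definition monomial u (alpha : multinom d) : X :=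
  word_prod (flatten [seq nseq (alpha i) (u i) | i <- enum 'I_d]).

(* P(u), for P without constant term *)
Definition poly_eval (P : mpoly d R[i]) u : X :=
  \sum_(alpha <- msupp P) mcoeff alpha P *: monomial u alpha.

Definition generated_algebra u : set X :=
  [set poly_eval P u | P in [set P : mpoly d R[i] |
                               meval (fun=> 0) P = 0]].

End MonomialsAndPolynomials.

Section Hypercyclicity.
Context {R : realType} {X : fAlgebraType R}.
Implicit Types (T : X -> X) (S : set X).

Definition subalgebra S : Prop :=
  [/\ S 0,
      forall x y, S x -> S y -> S (x + y),
      forall (k : R[i]) x, S x -> S (k *: x)
    & forall x y, S x -> S y -> S (amul x y)].

Definition HC T : set X := [set x | dense (range (fun n => iter n T x))].

Definition hypercyclic_algebra T S : Prop :=
  [/\ subalgebra S, S <> [set 0] & S `<=` HC T `|` [set 0]].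

Definition finitely_generated S : Prop :=
  exists (n : nat) (v : 'I_n -> X), S = generated_algebra v.

Definition criterion T (d : nat) : Prop :=
  forall (A : {fset multinom d}) (U : 'I_d -> set X) (V W : set X),
    A != fset0 -> mnm0 \notin A ->
    (forall i, open (U i) /\ U i !=set0) -> open V -> V !=set0 -> nbhs 0 W ->
  exists (u : 'I_d -> X) (beta : multinom d) (N : nat),
    [/\ forall i, U i (u i), beta \in A, (1 <= N)%N,
        V (iter N T (monomial u beta))
      & forall alpha, alpha \in A -> alpha != beta ->
          W (iter N T (monomial u alpha))].

End Hypercyclicity.

Definition separable (M : topologicalType) : Prop :=
  exists2 D : set M, countable D & dense D.

Definition residual (M : topologicalType) (S : set M) : Prop :=
  exists2 G : set M, Gdelta_dense G & G `<=` S.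

(* Main.v *)
(* Write A for the support of a polynomial P and c_a for its coefficients.  For
   a generic tuple u, the criterion provides, for every V and W, some b in A and
   n with T^n(u^b) in V and T^n(u^a) in W for the other a in A; for W small this
   says that T^n(P(u) / c_b) is in V.  Hence the orbits of the finitely many
   vectors P(u) / c_b, b in A, have a dense union.  Since the criterion (applied
   to the single monomial z_1) makes T topologically transitive, a closed
   T-invariant set is either nowhere dense or all of X, so one of these orbits is
   already dense, and so is that of P(u).  For the second part, Baire's theorem
   in X^N yields a dense sequence all of whose prefixes are generic.  Such a
   sequence is algebraically independent because 0 is not hypercyclic, and this
   prevents the algebra it generates from being finitely generated. *)
Require Import Defs.
From HB Require Import structures.
From mathcomp Require Import all_boot all_order all_algebra.
From mathcomp Require Import complex finmap.
From mathcomp Require Import all_classical all_reals all_analysis.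
From mathcomp Require Import -(notations) mpoly.
Set Implicit Arguments.
Unset Strict Implicit.
Unset Printing Implicit Defensive.


Import Order.TTheory GRing.Theory Num.Theory.
Import numFieldNormedType.Exports.
Local Open Scope classical_set_scope.
Local Open Scope ring_scope.
Local Open Scope complex_scope.

(** * Evaluation of polynomials without constant term *)

(** Links the condition P(0) = 0 in [generated_algebra] to the supports of polynomials, which then
    avoid the exponent 0. *)
Lemma meval_const0 (K : comNzRingType) (d : nat) (P : mpoly d K) :
  meval (fun=> 0) P = mcoeff mnm0 P.
Proof.
rewrite [P in LHS]mpolyE [P in RHS]mpolyE !raddf_sum; apply: eq_bigr => m _ /=.
rewrite mevalZ mevalX mcoeffZ mcoeffX; congr (_ * _).
have [->|m_neq0] := eqVneq m mnm0.
  by rewrite big1 // => i _; rewrite mnm0E.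
have [i mi] : exists i, m i != 0%N.
  apply/existsP; apply: contraNT m_neq0; rewrite negb_exists => /forallP m0.
  by apply/eqP/mnmP => i; rewrite mnm0E; apply/eqP; rewrite -[_ == _]negbK.
by rewrite (bigD1 i) //= expr0n (negbTE mi) mul0r.
Qed.

Section PolynomialEvaluation.
Context {R : realType} {X : fAlgebraType R}.
Implicit Types S : set X.

Lemma amul0l (x : X) : amul 0 x = 0.
Proof. by apply: (addrI (amul 0 x)); rewrite -amulDl !addr0. Qed.

Lemma amul0r (x : X) : amul x 0 = 0.
Proof. by apply: (addrI (amul x 0)); rewrite -amulDr !addr0. Qed.

Lemma amul_suml (I : Type) (r : seq I) (F : I -> X) x :
  amul (\sum_(i <- r) F i) x = \sum_(i <- r) amul (F i) x.
Proof.
by apply: (big_morph (amul^~ x)) => [y z|]; rewrite ?amulDl ?amul0l.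
Qed.

Lemma amul_sumr (I : Type) (r : seq I) (F : I -> X) x :
  amul x (\sum_(i <- r) F i) = \sum_(i <- r) amul x (F i).
Proof. by apply: (big_morph (amul x)) => [y z|]; rewrite ?amulDr ?amul0r. Qed.

Lemma subalgebra_sum S (I : eqType) (r : seq I) (F : I -> X) :
  subalgebra S -> (forall i, i \in r -> S (F i)) -> S (\sum_(i <- r) F i).
Proof.
move=> [S0 SD _ _] SF; rewrite big_seq.
by elim/big_ind: _ => // i /SF.
Qed.

Lemma subalgebra_word_prod S (s : seq X) :
  subalgebra S -> (forall x, x \in s -> S x) -> S (word_prod s).
Proof.
move=> [S0 _ _ SM]; case: s => //= x s.
elim: s x => [|y s IH] x Ss /=; first by apply: Ss; rewrite mem_head.
apply: IH => z; rewrite inE => /predU1P[->|zs].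
  by apply: SM; apply: Ss; rewrite !inE eqxx ?orbT.
by apply: Ss; rewrite !inE zs !orbT.
Qed.

Section FixedDimension.
Context {d : nat}.
Implicit Types (u : 'I_d -> X) (P Q : mpoly d R[i]).

(** The word of indices does not depend on [u]; induction on it gives continuity in [u]. *)
Lemma monomialE u (a : multinom d) : monomial u a =
  word_prod [seq u i | i <- flatten [seq nseq (a i) i | i <- enum 'I_d]].
Proof.
rewrite /monomial map_flatten -map_comp; congr (word_prod (flatten _)).
by apply: eq_map => i /=; rewrite map_nseq.
Qed.

Lemma monomial1 u (i : 'I_d) : monomial u (mnm1 i) = u i.
Proof.
rewrite /monomial; set s := flatten _; suff -> : s = [:: u i] by [].
rewrite /s {s}.
have : uniq (enum 'I_d) by exact: enum_uniq.
have : i \in enum 'I_d by rewrite mem_enum.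
have notin (t : seq 'I_d) : i \notin t ->
    flatten [seq nseq (mnm1 i j) (u j) | j <- t] = [::].
  elim: t => //= j t IH; rewrite inE negb_or => /andP[ij it].
  by rewrite IH // cats0 mnmE (negbTE ij).
elim: (enum _) => //= j t IH; rewrite inE => ijt /andP[jt Ut].
have [eij|nij] := eqVneq i j.
  by rewrite notin ?eij // mnmE eqxx.
rewrite mnmE (negbTE nij) /=; apply: IH => //.
by move: ijt; rewrite (negbTE nij).
Qed.

(** Exponents outside the support contribute 0, so polynomials with different supports can be
    evaluated over one common list. *)
Lemma poly_evalE u P (s : seq (multinom d)) :
  uniq s -> {subset msupp P <= s} ->
  poly_eval P u = \sum_(a <- s) mcoeff a P *: monomial u a.
Proof.
move=> Us sub; rewrite /poly_eval.
rewrite [RHS](bigID (mem (msupp P))) /= [X in _ + X]big1 ?addr0; last first.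
  by move=> a /memN_msupp_eq0 ->; rewrite scale0r.
rewrite -[RHS]big_filter; apply: perm_big; apply: uniq_perm.
- exact: msupp_uniq.
- exact: filter_uniq.
by move=> a; rewrite mem_filter; case: (boolP (a \in msupp P)) => //= /sub ->.
Qed.

Lemma poly_eval0 u : poly_eval 0 u = 0.
Proof. by rewrite /poly_eval msupp0 big_nil. Qed.

Lemma poly_evalD u P Q : poly_eval (P + Q) u = poly_eval P u + poly_eval Q u.
Proof.
pose s := undup (msupp P ++ msupp Q).
have Us : uniq s by exact: undup_uniq.
have sP : {subset msupp P <= s}.
  by move=> a aP; rewrite mem_undup mem_cat aP.
have sQ : {subset msupp Q <= s}.
  by move=> a aQ; rewrite mem_undup mem_cat aQ orbT.
have sD : {subset msupp (P + Q) <= s}.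
  by move=> a /msuppD_le; rewrite mem_undup.
rewrite (poly_evalE u Us sD) (poly_evalE u Us sP) (poly_evalE u Us sQ).
rewrite -big_split /=.
by apply: eq_bigr => a _; rewrite mcoeffD scalerDl.
Qed.

Lemma poly_evalZ u (c : R[i]) P : poly_eval (c *: P) u = c *: poly_eval P u.
Proof.
rewrite (poly_evalE u (msupp_uniq P)); last exact: msuppZ_le.
by rewrite scaler_sumr; apply: eq_bigr => a _; rewrite mcoeffZ scalerA.
Qed.

Lemma poly_eval_sum u (I : Type) (r : seq I) (F : I -> mpoly d R[i]) :
  poly_eval (\sum_(i <- r) F i) u = \sum_(i <- r) poly_eval (F i) u.
Proof.
by apply: (big_morph (poly_eval^~ u)) => [P Q|];
  rewrite ?poly_evalD ?poly_eval0.
Qed.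

Lemma poly_evalX u (a : multinom d) :
  poly_eval (mpolyX R[i] a) u = monomial u a.
Proof. by rewrite /poly_eval msuppX big_seq1 mcoeffX eqxx scale1r. Qed.

Lemma generated_algebra_sub S u :
  subalgebra S -> (forall i, S (u i)) -> generated_algebra u `<=` S.
Proof.
move=> Salg Su _ [P _ <-]; apply: subalgebra_sum => // a _.
have [_ _ SZ _] := Salg; apply: SZ; rewrite monomialE.
by apply: subalgebra_word_prod => // _ /mapP[i _ ->].
Qed.

Lemma generated_algebra_gen u i : generated_algebra u (u i).
Proof.
exists (mpolyX _ (mnm1 i)); last by rewrite poly_evalX monomial1.
by rewrite /= mevalXU.
Qed.

Hypothesis mulC : commutative (@amul _ X).

(* Adjoining [None] as a unit makes [amul] a commutative monoid law, to which
   the theory of big operators applies. *)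
Local Notation omul := (oAC (@amulA _ X) mulC).

Lemma Some_word_prod (s : seq X) : s != [::] ->
  Some (word_prod s) = \big[omul/None]_(x <- s) Some x.
Proof.
case: s => // x s _; elim: s x => [|y s IH] x; first by rewrite big_seq1.
by rewrite /= -/(word_prod (amul x y :: s)) IH !big_cons Monoid.mulmA.
Qed.

Lemma Some_monomial u (a : multinom d) : a != mnm0 -> Some (monomial u a) =
  \big[omul/None]_(i < d) \big[omul/None]_(x <- nseq (a i) (u i)) Some x.
Proof.
move=> a_neq0; rewrite /monomial Some_word_prod.
  by rewrite big_flatten big_map big_enum.
apply: contra_neq a_neq0 => s0; apply/mnmP => i; rewrite mnm0E.
apply/eqP; rewrite -leqn0 leqNgt; apply/negP => ai_gt0.
suff : u i \in [::] by [].
rewrite -s0; apply/flatten_mapP; exists i; first by rewrite mem_enum.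
by rewrite mem_nseq ai_gt0 eqxx.
Qed.

(** Nonzero exponents are essential: [monomial u mnm0] is the dummy value 0, not a unit. *)
Lemma monomialD u (a b : multinom d) : a != mnm0 -> b != mnm0 ->
  monomial u (mnm_add a b) = amul (monomial u a) (monomial u b).
Proof.
move=> a0 b0; apply: Some_inj; rewrite Some_monomial; last first.
  apply: contra_neq a0 => ab0; apply/mnmP => i; rewrite mnm0E.
  move/mnmP/(_ i): ab0; rewrite mnmDE mnm0E => /eqP.
  by rewrite addn_eq0 => /andP[/eqP].
rewrite -(oACE (@amulA _ X) mulC) !Some_monomial // -big_split.
by apply: eq_bigr => i _; rewrite mnmDE nseqD big_cat.
Qed.

(** Without constant terms, every pair of exponents in the expanded product is nonzero, so
    [monomialD] applies to it. *)
Lemma poly_evalM u P Q : mcoeff mnm0 P = 0 -> mcoeff mnm0 Q = 0 ->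
  poly_eval (P * Q) u = amul (poly_eval P u) (poly_eval Q u).
Proof.
have neq0 P' a : mcoeff mnm0 P' = 0 -> a \in msupp P' -> a != mnm0.
  by move=> P'0; apply: contraTneq => ->; rewrite mcoeff_msupp P'0 eqxx.
move=> P0 Q0; rewrite [P in LHS]mpolyE [Q in LHS]mpolyE mulr_suml.
rewrite poly_eval_sum amul_suml; apply: eq_big_seq => a aP.
rewrite mulr_sumr poly_eval_sum amul_sumr; apply: eq_big_seq => b bQ.
rewrite -scalerAl -scalerAr -mpolyXD !poly_evalZ poly_evalX.
by rewrite monomialD ?amulZl ?amulZr //; [exact: neq0 P0 aP|exact: neq0 Q0 bQ].
Qed.

Lemma generated_algebra_subalgebra u : subalgebra (generated_algebra u).
Proof.
split.
- by exists 0; rewrite ?poly_eval0 //= meval0.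
- move=> _ _ [P /= P0 <-] [Q /= Q0 <-]; exists (P + Q); last exact: poly_evalD.
  by rewrite /= mevalD P0 Q0 addr0.
- move=> k _ [P /= P0 <-]; exists (k *: P); last exact: poly_evalZ.
  by rewrite /= mevalZ P0 mulr0.
- move=> _ _ [P /= P0 <-] [Q /= Q0 <-]; exists (P * Q).
    by rewrite /= mevalM P0 mul0r.
  by apply: poly_evalM; rewrite -meval_const0.
Qed.

End FixedDimension.
End PolynomialEvaluation.

(** * Metric boxes and Baire's theorem for sequences *)

Lemma seq_radius {R : realType} (I : eqType) (s : seq I) (P : I -> R -> Prop) :
  (forall i e e', P i e -> e' <= e -> P i e') ->
  (forall i, i \in s -> exists2 e, 0 < e & P i e) ->
  exists2 e, 0 < e & forall i, i \in s -> P i e.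
Proof.
move=> Pdown; elim: s => [|j s IH] Ps; first by exists 1.
have [e1 e1_gt0 Pe1] := Ps j (mem_head _ _).
have [|e2 e2_gt0 Pe2] := IH.
  by move=> i si; apply: Ps; rewrite inE si orbT.
exists (Num.min e1 e2) => [|i]; first by rewrite lt_min e1_gt0.
rewrite inE => /predU1P[->|/Pe2]; [move: Pe1|]; move/Pdown; apply;
  by rewrite ge_min lexx ?orbT.
Qed.

Section Metric.
Context {R : realType} {X : fAlgebraType R} (dist : X -> X -> R).
Hypothesis dist0 : forall x y, dist x y = 0 <-> x = y.
Hypothesis distC : forall x y, dist x y = dist y x.
Hypothesis dist_triangle : forall x y z, dist x z <= dist x y + dist y z.
Hypothesis dist_nbhs : forall (x : X) (A : set X), nbhs x A <->
  exists2 e : R, 0 < e & [set y | dist x y < e] `<=` A.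

Lemma distxx x : dist x x = 0. Proof. exact/dist0. Qed.

Lemma dist_gt0 x y : x <> y -> 0 < dist x y.
Proof.
move=> xy; rewrite lt_neqAle; apply/andP; split.
  by apply/eqP => /esym/dist0.
have := dist_triangle x y x; rewrite distxx (distC y x).
by rewrite -mulr2n pmulrn_lge0.
Qed.

Lemma nbhs_dist x e : 0 < e -> nbhs x [set y | dist x y < e].
Proof. by move=> e_gt0; apply/dist_nbhs; exists e. Qed.

Lemma open_dist x e : open [set y | dist x y < e].
Proof.
rewrite openE => y /= xy; apply/dist_nbhs; exists (e - dist x y).
  by rewrite subr_gt0.
move=> z /= yz; apply: le_lt_trans (dist_triangle x y z) _.
by rewrite -ltrBrDl.
Qed.

(** Since only finitely many coordinates occur, a single radius suffices to describe the product
    topology. *)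
Lemma nbhs_ptws_dist {d : nat} (u : 'I_d -> X) (O : set ('I_d -> X)) :
  nbhs (u : {ptws 'I_d -> X}) O <->
  exists2 e : R, 0 < e & [set v | forall i, dist (u i) (v i) < e] `<=` O.
Proof.
split=> [uO|[e e_gt0 sub]]; last first.
  apply: (@filterS {ptws 'I_d -> X} _ _ _ _ sub).
  apply: (@filter_forall _ _ (fun i v => dist (u i) (v i) < e)
    _ (nbhs_filter (u : {ptws 'I_d -> X}))) => i.
  exact: (@proj_continuous _ (fun=> X) i u _ (nbhs_dist (u i) e_gt0)).
(* The product topology is a supremum, so convergence of the filter of boxes to [u] can be tested
   one coordinate at a time. *)
pose F := filter_from [set e : R | 0 < e]
  (fun e => [set v : 'I_d -> X | forall i, dist (u i) (v i) < e]).
suff /(_ O uO) : F --> (u : {ptws 'I_d -> X}) by move=> [e]; exists e.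
have FF : Filter F.
  apply: filter_from_filter; first by exists 1 => /=.
  move=> e1 e2 /= e1_gt0 e2_gt0; exists (Num.min e1 e2).
    by rewrite /= lt_min e1_gt0.
  by move=> v /= uv; split=> i; have := uv i; rewrite lt_min => /andP[].
apply/cvg_sup => i; apply/cvg_image.
  by rewrite eqEsubset; split => y // _; exists (fun=> y).
move=> A /dist_nbhs[e e_gt0 eA].
exists ((fun v : 'I_d -> X => v i) @^-1` A).
  by exists e => // v /(_ i) /eA.
by rewrite image_preimage // eqEsubset; split => y // _; exists (fun=> y).
Qed.

(* A direct proof of Baire's theorem in [X^N]: completeness is only available
   for the uniformity of [X], so the radii are also chosen so that the
   differences of points in the closed boxes tend to [0] coordinatewise. *)
Lemma baire_sequences (O : nat -> set (nat -> X)) :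
  (forall k x n e, 0 < e -> exists y m r, [/\ 0 < r,
     (forall i, (i < n)%N -> dist (x i) (y i) < e) &
     forall z, (forall i, (i < m)%N -> dist (y i) (z i) < r) -> O k z]) ->
  exists u, forall k, O k u.
Proof.
move=> Odense.
pose W k := [set z : X | dist 0 z < k.+1%:R^-1].
pose box (s : (nat -> X) * nat * R) :=
  [set z : nat -> X | forall i, (i < s.1.2)%N -> dist (s.1.1 i) (z i) <= s.2].
pose St := {s : (nat -> X) * nat * R | 0 < s.2}.
have step k (s : St) : exists t : St, [/\ (k < (val t).1.2)%N,
    box (val t) `<=` box (val s) `&` O k &
    forall i, (i < (val t).1.2)%N -> forall a b,
      dist ((val t).1.1 i) a <= (val t).2 ->
      dist ((val t).1.1 i) b <= (val t).2 -> W k (a - b)].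
  case: s => [[[x n] e] /= e_gt0].
  have [y [m [r [r_gt0 xy yO]]]] := Odense k x n e e_gt0.
  (* The new box constrains the [m] coordinates that force [O k], the [n] old ones for nesting, and
     coordinate [k], so that each coordinate is eventually constrained. *)
  pose m' := maxn (maxn m n) k.+1.
  (* The radius [e1] keeps the new box inside the old one, by the triangle inequality. *)
  have [|i si|e1 e1_gt0 Pe1] := @seq_radius R _ (iota 0 n)
    (fun i e1 => dist (x i) (y i) + e1 <= e).
  - by move=> i e1 e2 h e21; apply: le_trans h; rewrite lerD2l.
  - exists (e - dist (x i) (y i)); last by rewrite addrC subrK.
    by rewrite subr_gt0 xy //; move: si; rewrite mem_iota.
  (* The radius [e2] comes from continuity of subtraction at [(y i, y i)]. *)
  have [|i _|e2 e2_gt0 Pe2] := @seq_radius R _ (iota 0 m')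
    (fun i e2 => forall a b, dist (y i) a < e2 -> dist (y i) b < e2 ->
       W k (a - b)).
  - move=> i e2 e3 h e32 a b ya yb.
    by apply: h; [exact: lt_le_trans ya e32|exact: lt_le_trans yb e32].
  - have : nbhs (y i - y i) (W k).
      by rewrite subrr; apply: nbhs_dist; rewrite invr_gt0 ltr0n.
    move=> /(@sub_continuous X (y i, y i) (W k)) [[A B] /=
      [/dist_nbhs[ea ea0 eaA] /dist_nbhs[eb eb0 ebB]] AB].
    exists (Num.min ea eb); first by rewrite lt_min ea0.
    move=> a b; rewrite !lt_min => /andP[/eaA Aa _] /andP[_ /ebB Bb].
    exact: (AB (a, b)).
  (* Boxes are closed while the bounds [r] and [e2] are strict, hence the halves. *)
  pose r' := Num.min (r / 2) (Num.min e1 (e2 / 2)).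
  have r'_gt0 : 0 < r' by rewrite !lt_min e1_gt0 !divr_gt0.
  have r'r : r' < r.
    by rewrite gt_min ltr_pdivrMr // ltr_pMr // ltr1n.
  have r'e1 : r' <= e1 by rewrite !ge_min lexx orbT.
  have r'e2 : r' < e2.
    by rewrite !gt_min [e2 / 2 < _]ltr_pdivrMr // ltr_pMr // ltr1n !orbT.
  exists (exist _ (y, m', r') r'_gt0); split=> /=.
  - by rewrite leq_max leqnn orbT.
  - move=> z /= yz; split.
      move=> i /= i_n; apply: le_trans (dist_triangle _ (y i) _) _.
      apply: le_trans (Pe1 i _); last by rewrite mem_iota.
      rewrite lerD2l (le_trans _ r'e1) // yz //.
      by rewrite !leq_max i_n orbT.
    apply: yO => i im; apply: le_lt_trans r'r; apply: yz.
    by rewrite !leq_max im.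
  - move=> i im' a b ya yb; apply: (Pe2 i); first by rewrite mem_iota.
      exact: le_lt_trans ya r'e2.
    exact: le_lt_trans yb r'e2.
have [f fP] := choice (fun ks => step ks.1 ks.2).
(* The starting box constrains no coordinate: it is the whole space. *)
pose s : nat -> St :=
  nat_rect _ (exist _ ((fun=> 0), 0%N, 1) ltr01) (fun k t => f (k, t)).
have sP k := fP (k, s k).
pose x j := (val (s j)).1.1.
have nested k j : (k <= j)%N -> box (val (s j)) `<=` box (val (s k)).
  elim: j => [|j IH]; first by rewrite leqn0 => /eqP->.
  rewrite leq_eqVlt => /predU1P[->//|/IH]; apply: subset_trans.
  by have [_ + _] := sP j; move=> /subset_trans; apply; exact: subIsetl.
have xbox k j : (k <= j)%N -> box (val (s k)) (x j).
  move=> /nested; apply => i _ /=; rewrite distxx; exact: ltW (valP (s j)).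
have xcvg i : exists ui : X, x j i @[j --> \oo] --> ui.
  apply: tvs_cauchy_cvg => U /dist_nbhs[e e_gt0 eU].
  have [k0 k0e] : exists k, k.+1%:R^-1 < e.
    have [k _ kP] := @near_infty_natSinv_lt R (PosNum e_gt0).
    by exists k; apply: kP => /=.
  (* Here [k >= i] makes coordinate [i] constrained in box [k.+1], and [k >= k0] makes [W k] small
     enough. *)
  pose k := maxn k0 i.
  have [k_s _ Wk] := sP k.
  exists [set a | dist (x k.+1 i) a <= (val (s k.+1)).2].
    exists k.+1 => // j /= kj; apply: (xbox k.+1) => //.
    by apply: leq_ltn_trans k_s; rewrite leq_maxr.
  move=> a b /= xa xb; apply: eU => /=.
  apply: lt_trans k0e; apply: lt_le_trans (Wk i _ a b xa xb) _.
    by apply: leq_ltn_trans k_s; rewrite leq_maxr.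
  by rewrite lef_pV2 ?posrE ?ltr0n // ler_nat ltnS leq_maxl.
have [u uP] := choice xcvg.
exists u => k; have [_ sub _] := sP k.
(* The limit stays in each closed box: otherwise a late [x j], closer to [u] than the excess over
   the radius, would leave the box too. *)
suff /sub [] : box (val (s k.+1)) u by [].
move=> i /= ik; rewrite leNgt; apply/negP => lt_u.
rewrite -subr_gt0 in lt_u; have [j0 _ j0P] := uP i _ (nbhs_dist (u i) lt_u).
have := xbox k.+1 (maxn j0 k.+1) (leq_maxr _ _) i ik.
have := j0P (maxn j0 k.+1) (leq_maxl _ _); rewrite /= distC ltrBrDr => xu xk.
have := dist_triangle (x k.+1 i) (x (maxn j0 k.+1) i) (u i).
by rewrite leNgt addrC (le_lt_trans _ xu) // lerD2l.
Qed.

End Metric.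

(** * Transitivity and hypercyclic vectors *)

Section Dynamics.
Context {R : realType} {X : fAlgebraType R}.

Lemma scalel_continuous (k : R[i]) : continuous (fun x : X => k *: x).
Proof.
move=> x; apply: (@continuous2_cvg _ R[i]^o X X _ (nbhs_filter x)
  (fun=> k) id (fun a y => a *: y) k x).
- exact: (@scale_continuous _ X (k, x)).
- exact: cvg_cst.
- exact: cvg_id.
Qed.

Lemma monomial_continuous {d : nat} (a : multinom d) :
  continuous (fun u : {ptws 'I_d -> X} => monomial u a).
Proof.
pose C (f : {ptws 'I_d -> X} -> X) := continuous f.
have foldl_cont (s : seq 'I_d) (f : {ptws 'I_d -> X} -> X) : C f ->
    C (fun u => foldl amul (f u) [seq u i | i <- s]).
  elim: s f => [//|i s IH] f fC; apply: (IH (fun u => amul (f u) (u i))) => u.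
  apply: (@continuous2_cvg _ X X X _ (nbhs_filter u) f (fun v => v i)
    (@amul _ X)).
  - exact: (@amul_continuous _ X (f u, u i)).
  - exact: fC.
  - exact: (@proj_continuous _ (fun=> X) i u).
suff : C (fun u => monomial u a) by [].
have -> : (fun u => monomial u a) = (fun u : {ptws 'I_d -> X} => word_prod
    [seq u i | i <- flatten [seq nseq (a i) i | i <- enum 'I_d]]).
  by apply/funext => u; exact: monomialE.
case: (flatten _) => [|i s] /=; first exact: cst_continuous.
exact/foldl_cont/(@proj_continuous _ (fun=> X) i).
Qed.

Lemma nbhs_lincomb (I : eqType) (s : seq I) (k : I -> R[i]) (y : X) V :
  nbhs y V -> exists V' W, [/\ nbhs y V', nbhs 0 W &
    forall x (w : I -> X), V' x -> (forall i, i \in s -> W (w i)) ->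
      V (x + \sum_(i <- s) k i *: w i)].
Proof.
elim: s V => [|i s IH] V yV.
  by exists V, setT; split=> // [|x w]; [exact: filterT|rewrite big_nil addr0].
have : nbhs (y + 0) V by rewrite addr0.
move=> /(@add_continuous X (y, 0))[[A B] /= [yA B0] AB].
have [V' [W [yV' W0 V'W]]] := IH _ yA.
exists V', (W `&` [set w | B (k i *: w)]); split=> //.
  apply: filterI => //; apply: (@scalel_continuous (k i) 0).
  by rewrite scaler0.
move=> x w V'x Ww; rewrite big_cons addrCA addrC.
apply: (AB (_, _)); split=> /=; last by apply: (Ww i _).2; rewrite mem_head.
by apply: V'W => // j js; apply: (Ww j _).1; rewrite inE js orbT.
Qed.

(** One pair [V'], [W] serves all coefficient families [k j]. This uniformity matters because the
    criterion reveals the dominant exponent only after [W] is chosen. *)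
Lemma nbhs_lincombs (I J : eqType) (t : seq J) (s : seq I)
    (k : J -> I -> R[i]) (y : X) V :
  nbhs y V -> exists V' W, [/\ nbhs y V', nbhs 0 W &
    forall j x (w : I -> X), j \in t -> V' x ->
      (forall i, i \in s -> W (w i)) -> V (x + \sum_(i <- s) k j i *: w i)].
Proof.
move=> yV; elim: t => [|j t [V1 [W1 [yV1 W10 VW1]]]].
  by exists setT, setT; split=> //; exact: filterT.
have [V2 [W2 [yV2 W20 VW2]]] := @nbhs_lincomb _ s (k j) y V yV.
exists (V1 `&` V2), (W1 `&` W2); split; try exact: filterI.
move=> j' x w; rewrite inE => /predU1P[->|j't] [V1x V2x] Ww.
  by apply: VW2 => // i /Ww[].
by apply: VW1 => // i /Ww[].
Qed.

(** Balls of radius 1/(n+1), centred at a dense sequence for [B] and at 0 for [W]. They reduce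
    genericity to countably many conditions. *)
Lemma countable_neighborhoods : separable X ->
  exists (B : nat * nat -> set X) (W : nat -> set X),
  [/\ forall p, open (B p) /\ B p !=set0,
      forall V : set X, open V -> V !=set0 -> exists p, B p `<=` V,
      forall n, open (W n) /\ W n 0
    & forall V : set X, nbhs 0 V -> exists n, W n `<=` V].
Proof.
move=> [D Dcount Ddense]; have [dist [d0 dC dT dN]] := @metrizable_topology R X.
have [q Dq] : exists q : nat -> X, D `<=` range q.
  have [D0|[f]] := pfcard_geP Dcount; first by exists (fun=> 0); rewrite D0.
  by exists f => x /(@surj _ _ _ _ f).
have inv_lt (e : R) : 0 < e -> exists n : nat, n.+1%:R^-1 < e.
  move=> e_gt0; have [n _ nP] := @near_infty_natSinv_lt R (PosNum e_gt0).
  by exists n; apply: nP => /=.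
have inv_gt0 n : 0 < n.+1%:R^-1 :> R by rewrite invr_gt0 ltr0n.
pose ball (x : X) n := [set y | dist x y < n.+1%:R^-1].
have ball_open x n : open (ball x n) by exact: open_dist.
have ball_center x n : ball x n x by rewrite /ball /= (distxx d0).
have ball_sub x V : nbhs x V -> exists n, ball x n `<=` V.
  move=> /dN[e /inv_lt[n ne] eV]; exists n; apply: subset_trans eV => y /= xy.
  exact: lt_trans xy ne.
exists (fun p => ball (q p.1) p.2), (ball 0); split.
- by move=> p; split=> //; exists (q p.1).
- move=> V Vo V0; have [y [Vy /Dq[a _ qa]]] := Ddense V V0 Vo.
  rewrite -qa in Vy; have [n nV] := @ball_sub _ _ (open_nbhs_nbhs (conj Vo Vy)).
  by exists (a, n).
- by move=> n; split.
- exact: ball_sub.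
Qed.

Section Operator.
Variable T : {linear X -> X}.
Hypothesis T_cont : continuous T.

Lemma iter_continuous n : continuous (iter n T).
Proof.
elim: n => [|n IH] x; first exact: cvg_id.
by apply: (@continuous_comp X X X (iter n T) T x); [exact: IH|exact: T_cont].
Qed.

Lemma iter_lincomb n (I : Type) (s : seq I) (k : I -> R[i]) (w : I -> X) :
  iter n T (\sum_(i <- s) k i *: w i) = \sum_(i <- s) k i *: iter n T (w i).
Proof.
elim: n => //= n ->; rewrite linear_sum.
by apply: eq_bigr => i _; rewrite linearZ.
Qed.

Lemma iterZ n (k : R[i]) x : iter n T (k *: x) = k *: iter n T x.
Proof. by elim: n => //= n ->; rewrite linearZ. Qed.

Lemma HC_scale (k : R[i]) x : HC T x -> k != 0 -> HC T (k *: x).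
Proof.
move=> xHC k0 V [y Vy] Vo.
have [|z [Vz [n _ nz]]] := xHC ((fun x => k *: x) @^-1` V) _
    (open_comp (fun x _ => @scalel_continuous k x) Vo).
  by exists (k^-1 *: y); rewrite /= scalerA divff // scale1r.
by exists (k *: z); split=> //; exists n => //; rewrite iterZ nz.
Qed.

(** The orbit of 0 stays at 0 and misses the set of nonzero vectors, which is nonempty and, by
    metrizability, open. *)
Lemma HC_neq0 : (exists x : X, x != 0) -> ~ HC T 0.
Proof.
move=> [x /eqP x0] HC0.
have [dist [d0 dC dT dN]] := @metrizable_topology R X.
have [||y [/= y0 [n _ ny]]] := HC0 [set y | y != 0].
- by exists x; exact/eqP.
- rewrite openE => y /eqP y0; apply/dN; exists (dist y 0).
    exact: dist_gt0.
  move=> z /= yz; apply/eqP => z0; move: yz; rewrite z0.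
  by rewrite ltxx.
- move: y0; rewrite -ny; suff -> : iter n T 0 = 0 by rewrite eqxx.
  by have := iterZ n 0 0; rewrite !scale0r.
Qed.

Definition transitive_operator := forall U V : set X,
  open U -> U !=set0 -> open V -> V !=set0 ->
  exists x n, U x /\ V (iter n T x).

Lemma criterion_transitive (d : nat) :
  (1 <= d)%N -> criterion T d -> transitive_operator.
Proof.
case: d => // d _ crit U V Uo U0 Vo V0.
have [||||||u [b [n [Uu]]]] := crit [fset mnm1 ord0]%fset (fun=> U) V setT.
- by apply/fset0Pn; exists (mnm1 ord0); rewrite inE.
- rewrite inE; apply/negP => /eqP /mnmP /(_ ord0).
  by rewrite !mnmE.
- by move=> _.
- by [].
- by [].
- exact: filterT.
rewrite inE => /eqP-> _; rewrite monomial1 => Vn _.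
by exists (u ord0), n.
Qed.

(** By induction on the list: transitivity sends some point of the current [V] into the next [O i]
    at a time [n], and [V] shrinks to its intersection with the preimage of [O i] under the [n]-th
    iterate. *)
Lemma transitive_common_return (I : eqType) (s : seq I) (O : I -> set X) :
  transitive_operator ->
  (forall i, i \in s -> open (O i) /\ O i !=set0) ->
  exists V : set X, [/\ open V, V !=set0 &
    forall i, i \in s -> exists n, forall x, V x -> O i (iter n T x)].
Proof.
move=> trans; elim: s => [_|i s IH sO].
  by exists setT; split=> //; [exact: openT|exists 0].
have [|V [Vo V0 VO]] := IH.
  by move=> j js; apply: sO; rewrite inE js orbT.
have [Oo O0] := sO i (mem_head _ _).
have [x [n [Vx Ox]]] := trans V (O i) Vo V0 Oo O0.
exists (V `&` iter n T @^-1` O i); split.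
- apply: openI => //; apply: open_comp => // y _; exact: iter_continuous.
- by exists x.
- move=> j; rewrite inE => /predU1P[->|/VO[m mP]].
    by exists n => y [].
  by exists m => y [/mP].
Qed.

Definition return_set {d : nat} (A : {fset multinom d}) (V W : set X) :
    set ('I_d -> X) :=
  [set u | exists beta n, [/\ beta \in A, V (iter n T (monomial u beta)) &
    forall alpha, alpha \in A -> alpha != beta ->
      W (iter n T (monomial u alpha))]].

Definition generic_tuple {d : nat} (u : 'I_d -> X) :=
  forall (A : {fset multinom d}) (V W : set X), A != fset0 -> mnm0 \notin A ->
    open V -> V !=set0 -> nbhs 0 W -> return_set A V W u.

Lemma return_set_open {d : nat} (A : {fset multinom d}) V W :
  open V -> open W -> @open {ptws 'I_d -> X} (return_set A V W).
Proof.
move=> Vo Wo; rewrite openE => u [b [n [bA Vb Wa]]].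
have mono_nbhs a (O : set X) : open O -> O (iter n T (monomial u a)) ->
    \forall v \near (u : {ptws 'I_d -> X}), O (iter n T (monomial v a)).
  move=> Oo Ou; have := @monomial_continuous d a u.
  move=> /continuous_comp /(_ (@iter_continuous n _)); apply.
  exact: open_nbhs_nbhs.
have Vnear := mono_nbhs b V Vo Vb.
have Wnear : \forall v \near (u : {ptws 'I_d -> X}),
    forall a : A, val a != b -> W (iter n T (monomial v (val a))).
  (* Quantifying over the finite type [A] keeps the intersection of neighbourhoods finite. *)
  apply: (@filter_forall _ _ _ _ (nbhs_filter (u : {ptws 'I_d -> X}))) => a.
  have [ab|ab] := eqVneq (val a) b; first by apply: nearW => v.
  have Wu := mono_nbhs (val a) W Wo (Wa _ (valP a) ab).
  by apply: (@filterS _ _ (nbhs_filter (u : {ptws 'I_d -> X}))) Wu => v Wv.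
have FF := nbhs_filter (u : {ptws 'I_d -> X}).
apply: filterS (filterI Vnear Wnear) => v [Vv Wv].
exists b, n; split=> // a aA; exact: (Wv [` aA]%fset).
Qed.

(** The criterion is applied to balls around the coordinates of [u]. *)
Lemma return_set_dense {d : nat} (A : {fset multinom d}) V W :
  criterion T d -> A != fset0 -> mnm0 \notin A ->
  open V -> V !=set0 -> nbhs 0 W ->
  forall u O, nbhs (u : {ptws 'I_d -> X}) O ->
  exists v, O v /\ return_set A V W v.
Proof.
move=> crit A0 A0' Vo V0 W0 u O.
have [dist [d0 dC dT dN]] := @metrizable_topology R X.
move=> /(nbhs_ptws_dist dN)[e e_gt0 eO].
have [|v [b [n [uv bA _ Vv Wv]]]] :=
  crit A (fun i => [set y | dist (u i) y < e]) V W A0 A0' _ Vo V0 W0.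
  move=> i; split; first exact: open_dist.
  by exists (u i); rewrite /= (distxx d0).
by exists v; split; [exact: eO|exists b, n].
Qed.

(* For [P] with support [A], the scalings [P(u) / c_beta], [beta \in A], have
   orbits whose union is dense.  If none of these orbits were dense,
   transitivity would give an open set [V] whose points all visit, for every
   [beta], an open set avoided by the orbit of [P(u) / c_beta]. *)
Lemma generic_poly_HC {d : nat} (u : 'I_d -> X) (P : mpoly d R[i]) :
  transitive_operator -> generic_tuple u -> P != 0 -> mcoeff mnm0 P = 0 ->
  HC T (poly_eval P u).
Proof.
move=> trans gen P_neq0 P0; apply: contrapT => notHC.
pose c a := mcoeff a P.
pose A : {fset multinom d} := [fset a in msupp P]%fset.
have AE a : (a \in A) = (a \in msupp P) by rewrite inE.
have c_neq0 b : b \in msupp P -> c b != 0 by rewrite mcoeff_msupp.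
(* The support condition sits inside the existential so that [choice] yields a total function; off
   the support any set will do. *)
have avoid b : exists O : set X, b \in msupp P -> [/\ open O, O !=set0 &
    forall n, ~ O (iter n T ((c b)^-1 *: poly_eval P u))].
  apply: contrapT => nO; apply: notHC.
  have bP : b \in msupp P.
    by apply/negPn/negP => /negP bP; apply: nO; exists setT.
  have /HC_scale/(_ (c_neq0 b bP)) : HC T ((c b)^-1 *: poly_eval P u).
    move=> O O0 Oo; apply: contrapT => nOn.
    apply: nO; exists O => _; split=> //.
    by move=> n On; apply: nOn; eexists; split; [exact: On|exists n].
  by rewrite scalerA divff ?c_neq0 // scale1r.
have [ O OP] := choice avoid.
have [b bP|V [Vo [y Vy] VO]] := @transitive_common_return _ (msupp P) O trans.
  by have [] := OP b bP.
have [V' [W [yV' W0 V'W]]] := @nbhs_lincombs _ _ (msupp P) (msupp P)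
  (fun b a => if a == b then 0 else (c b)^-1 * c a) y V
  (open_nbhs_nbhs (conj Vo Vy)).
(* Genericity needs an open target, and [V'] is only a neighbourhood of [y]. *)
have [ | | | | |b [n [bA Vb Wa]]] := gen A (interior V') W.
- have [a aP] : exists a, a \in msupp P.
    move: P_neq0; rewrite -msupp_eq0; case: (msupp P) => // a s _.
    by exists a; rewrite mem_head.
  by apply/fset0Pn; exists a; rewrite AE.
- by rewrite AE mcoeff_msupp P0 eqxx.
- exact: open_interior.
- by exists y.
- by [].
have bP : b \in msupp P by rewrite -AE.
(* After [n] steps the scaled vector will lie in [V], and [m] further steps take it into [O b],
   which its orbit avoids. *)
have [m mP] := VO b bP; have [_ _ /(_ (m + n)%N)] := OP b bP; apply.
rewrite iterD; apply: mP.
(* The dominant term is set to 0, which lies in [W], so the bound holds on the whole support. *)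
pose w a := if a == b then 0 else iter n T (monomial u a).
have -> : iter n T ((c b)^-1 *: poly_eval P u) = iter n T (monomial u b) +
    \sum_(a <- msupp P) (if a == b then 0 else (c b)^-1 * c a) *: w a.
  rewrite iterZ /poly_eval iter_lincomb scaler_sumr.
  rewrite (bigD1_seq b) ?msupp_uniq //= [in RHS](bigD1_seq b) ?msupp_uniq //=.
  rewrite eqxx scale0r add0r scalerA mulVf ?c_neq0 // scale1r; congr (_ + _).
  by apply: eq_bigr => a /negbTE ab; rewrite /w ab scalerA.
apply: (V'W b) => //; first exact: interior_subset Vb.
move=> a aP; rewrite /w; case: eqVneq => [_|ab]; first exact: nbhs_singleton.
by apply: Wa => //; rewrite AE.
Qed.

Hypothesis X_neq0 : exists x : X, x != 0.
Hypothesis X_comm : commutative (@amul _ X).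

Lemma generic_hypercyclic_algebra {d : nat} (u : 'I_d -> X) :
  (1 <= d)%N -> transitive_operator -> generic_tuple u ->
  hypercyclic_algebra T (generated_algebra u).
Proof.
case: d u => // d u _ trans gen; split.
- exact: generated_algebra_subalgebra.
- move=> gen0; have := generated_algebra_gen u ord0; rewrite gen0 /= => u0.
  apply: (HC_neq0 X_neq0); rewrite -u0 -(monomial1 u ord0) -poly_evalX.
  have X0 : mcoeff mnm0 (mpolyX R[i] (@mnm1 d.+1 ord0)) = 0.
    by rewrite -meval_const0 mevalXU.
  apply: generic_poly_HC => //.
  apply/negP => /eqP /(congr1 (mcoeff (mnm1 ord0))).
  by rewrite mcoeffX eqxx mcoeff0 => /eqP; rewrite oner_eq0.
- move=> _ [P /= P0 <-]; have [->|P_neq0] := eqVneq P 0.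
    by right; rewrite poly_eval0.
  by left; apply: generic_poly_HC; rewrite // -meval_const0.
Qed.

End Operator.
End Dynamics.

(** * Countably generated algebras *)

Definition prefix_tuple {M : Type} (n : nat) (u : nat -> M) : 'I_n -> M :=
  fun i => u i.
Arguments prefix_tuple {M} n u i.

Section InfinitelyManyGenerators.
Context {R : realType} {X : fAlgebraType R}.
Hypothesis X_neq0 : exists x : X, x != 0.
Hypothesis X_comm : commutative (@amul _ X).
Variable T : {linear X -> X}.
Hypothesis T_cont : continuous T.
Hypothesis T_trans : transitive_operator T.

Lemma generated_algebra_prefix (u : nat -> X) m n : (m <= n)%N ->
  generated_algebra (prefix_tuple m u) `<=`
  generated_algebra (prefix_tuple n u).
Proof.
move=> mn; apply: generated_algebra_sub.
  exact: generated_algebra_subalgebra.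
move=> i; exact: (generated_algebra_gen (prefix_tuple n u) (widen_ord mn i)).
Qed.

(* A generator is not a polynomial in the previous ones, since nonzero
   polynomials take values in [HC T], which does not contain [0]. *)
Lemma generic_prefix_notin (u : nat -> X) m :
  generic_tuple T (prefix_tuple m.+1 u) ->
  ~ generated_algebra (prefix_tuple m u) (u m).
Proof.
(* [S] consists of the values at [v] of polynomials free of the last variable. It is a subalgebra
   containing the earlier generators, hence the algebra they generate. *)
move=> gen; pose v := prefix_tuple m.+1 u.
pose S := [set poly_eval P v | P in [set P : mpoly m.+1 R[i] |
  meval (fun=> 0) P = 0 /\ forall a, a \in msupp P -> a ord_max = 0%N]].
have S_alg : subalgebra S.
  split.
  - exists 0; rewrite ?poly_eval0 //=; split; first exact: meval0.
    by move=> a; rewrite msupp0.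
  - move=> _ _ [P [P0 Pm] <-] [Q [Q0 Qm] <-].
    exists (P + Q); last exact: poly_evalD.
    split; first by rewrite mevalD P0 Q0 addr0.
    by move=> a /msuppD_le; rewrite mem_cat => /orP[/Pm|/Qm].
  - move=> k _ [P [P0 Pm] <-]; exists (k *: P); last exact: poly_evalZ.
    split; first by rewrite mevalZ P0 mulr0.
    by move=> a /msuppZ_le /Pm.
  - move=> _ _ [P [P0 Pm] <-] [Q [Q0 Qm] <-]; exists (P * Q); last first.
      by apply: poly_evalM => //; rewrite -meval_const0.
    split; first by rewrite mevalM P0 mul0r.
    move=> a /msuppM_le /allpairsP[[b c] /= [/Pm b0 /Qm c0 ->]].
    by rewrite mnmDE b0 c0.
have S_gen i : S (prefix_tuple m u i).
  exists (mpolyX _ (mnm1 (widen_ord (leqnSn m) i))); last first.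
    by rewrite poly_evalX monomial1.
  split; first by rewrite mevalXU.
  move=> a; rewrite msuppX inE => /eqP ->; rewrite mnmE.
  by rewrite -val_eqE /= ltn_eqF.
move=> /(generated_algebra_sub S_alg S_gen)[P [P0 Pm] Pu].
(* If [u m] were P(v) with P free of the last variable z, then Q = z - P would vanish at [v], yet
   its coefficient at z is 1. *)
pose Q := mpolyX R[i] (@mnm1 m.+1 ord_max) + (-1) *: P.
have Q0 : mcoeff mnm0 Q = 0.
  by rewrite -meval_const0 mevalD mevalXU mevalZ P0 mulr0 addr0.
have Q_neq0 : Q != 0.
  apply/negP => /eqP /(congr1 (mcoeff (mnm1 ord_max))).
  rewrite mcoeffD mcoeffZ mcoeffX eqxx mcoeff0 memN_msupp_eq0.
    by rewrite mulr0 addr0 => /eqP; rewrite oner_eq0.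
  by apply/negP => /Pm; rewrite mnmE eqxx.
apply: (HC_neq0 (T := T) X_neq0).
have <- : poly_eval Q v = 0.
  by rewrite poly_evalD poly_evalZ poly_evalX monomial1 Pu scaleN1r subrr.
exact: generic_poly_HC.
Qed.

Definition infinite_algebra (u : nat -> X) : set X :=
  \bigcup_n generated_algebra (prefix_tuple n.+1 u).

Lemma infinite_algebra_gen (u : nat -> X) i : infinite_algebra u (u i).
Proof. by exists i => //; exact: (generated_algebra_gen _ ord_max). Qed.

Lemma infinite_algebra_subalgebra (u : nat -> X) :
  subalgebra (infinite_algebra u).
Proof.
have alg n := generated_algebra_subalgebra X_comm (prefix_tuple n.+1 u).
have widen n m := @generated_algebra_prefix u n.+1 m.+1.
split.
- by exists 0%N => //; have [] := alg 0%N.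
- move=> x y [n _ xn] [m _ ym]; exists (maxn n m) => //.
  have [_ SD _ _] := alg (maxn n m); apply: SD.
    by apply: (widen n) => //; rewrite ltnS leq_maxl.
  by apply: (widen m) => //; rewrite ltnS leq_maxr.
- move=> k x [n _ xn]; exists n => //.
  by have [_ _ SZ _] := alg n; exact: SZ.
- move=> x y [n _ xn] [m _ ym]; exists (maxn n m) => //.
  have [_ _ _ SM] := alg (maxn n m); apply: SM.
    by apply: (widen n) => //; rewrite ltnS leq_maxl.
  by apply: (widen m) => //; rewrite ltnS leq_maxr.
Qed.

Lemma infinite_algebra_hypercyclic (u : nat -> X) :
  (forall n, generic_tuple T (prefix_tuple n.+1 u)) ->
  hypercyclic_algebra T (infinite_algebra u).
Proof.
move=> gen.
have hc n := generic_hypercyclic_algebra T_cont X_neq0 X_comm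
  (ltn0Sn n) T_trans (gen n).
split; first exact: infinite_algebra_subalgebra.
- move=> S0; have [[gen0 _ _ _] neq0 _] := hc 0%N; apply: neq0.
  rewrite eqEsubset; split=> [x x1|_ -> //].
  by rewrite -S0; exists 0%N.
- by move=> x [n _ xn]; have [_ _] := hc n; apply.
Qed.

(** Finitely many generators lie in the algebra of one common prefix; the next term of [u] would
    then lie there too, against [generic_prefix_notin]. *)
Lemma infinite_algebra_not_fg (u : nat -> X) :
  (forall n, generic_tuple T (prefix_tuple n.+1 u)) ->
  ~ finitely_generated (infinite_algebra u).
Proof.
move=> gen [n [v Sv]].
have vS j : infinite_algebra u (v j).
  by rewrite Sv; exact: generated_algebra_gen.
have vm j : exists m, generated_algebra (prefix_tuple m.+1 u) (v j).
  by have [m _ mP] := vS j; exists m.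
have [f fP] := choice vm.
pose M := \max_(j < n) f j.
apply: (@generic_prefix_notin u M.+1 (gen M.+1)).
have := infinite_algebra_gen u M.+1; rewrite Sv; apply: generated_algebra_sub.
  exact: generated_algebra_subalgebra.
move=> j; apply: (@generated_algebra_prefix u (f j).+1) => //.
by rewrite ltnS leq_bigmax.
Qed.

End InfinitelyManyGenerators.

(** * Existence of generic tuples and of dense generic sequences *)

Section GenericExistence.
Context {R : realType} {X : fAlgebraType R}.
Variable T : {linear X -> X}.
Hypothesis T_cont : continuous T.

(** Return sets grow with [V] and [W], so testing on arbitrarily small sets suffices. *)
Lemma generic_tuple_countable {d : nat} (B : nat * nat -> set X)
    (W : nat -> set X) (u : 'I_d -> X) :
  (forall V : set X, open V -> V !=set0 -> exists p, B p `<=` V) ->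
  (forall V : set X, nbhs 0 V -> exists n, W n `<=` V) ->
  (forall A p n, A != fset0 -> mnm0 \notin A ->
    return_set T A (B p) (W n) u) ->
  generic_tuple T u.
Proof.
move=> Bsub Wsub ret A V W' A0 A0' Vo V0 /Wsub[n nW].
have [p pV] := Bsub V Vo V0; have [b [N [bA Vb Wa]]] := ret A p n A0 A0'.
by exists b, N; split=> // [|a aA ab]; [exact: pV|exact/nW/Wa].
Qed.

Lemma generic_tuple_residual {d : nat} : separable X -> criterion T d ->
  residual [set u : {ptws 'I_d -> X} | generic_tuple T u].
Proof.
move=> /countable_neighborhoods[B [W [BP Bsub WP Wsub]]] crit.
pose J : countType := ({fset multinom d} * (nat * nat) * nat)%type.
pose O (j : J) : set {ptws 'I_d -> X} :=
  if (j.1.1 != fset0) && (mnm0 \notin j.1.1)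
  then return_set T j.1.1 (B j.1.2) (W j.2) else setT.
(* Numbers that encode no condition impose none. *)
pose F k := if @choice.unpickle J k is Some j then O j else setT.
exists (\bigcap_k F k).
  exists F => // k; rewrite /F.
  have T_od : open [set: {ptws 'I_d -> X}] /\ dense [set: {ptws 'I_d -> X}].
    split; first exact: openT.
    by move=> U [u Uu] _; exists u.
  case: (@choice.unpickle J k) => // -[[A p] n]; rewrite /O /=.
  case: ifP => // /andP[A0 A0'].
  have [Bo B0] := BP p; have [Wo W0] := WP n.
  split; first exact: return_set_open.
  move=> U [u Uu] Uo; have Wnbhs := open_nbhs_nbhs (conj Wo W0).
  have [v [Uv vA]] := return_set_dense crit A0 A0' Bo B0 Wnbhs
    (open_nbhs_nbhs (conj Uo Uu)).
  by exists v.
move=> u Fu; apply: (generic_tuple_countable Bsub Wsub) => A p n A0 A0'.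
have := Fu (choice.pickle ((A, p, n) : J)) I; rewrite /F choice.pickleK /O /=.
by rewrite A0 A0'.
Qed.

Lemma dense_generic_sequence : separable X ->
  (forall d, (1 <= d)%N -> criterion T d) ->
  exists u : nat -> X, dense (range u) /\
    forall n, generic_tuple T (prefix_tuple n.+1 u).
Proof.
move=> /countable_neighborhoods[B [W [BP Bsub WP Wsub]]] crit.
have [dist [d0 dC dT dN]] := @metrizable_topology R X.
(* Left indices encode genericity of the prefix of length [d.+1], right ones density of the range.
   Each condition involves finitely many coordinates. *)
pose J : countType :=
  ({d : nat & {fset multinom d.+1}} * (nat * nat) * nat + nat * nat)%type.
pose O (j : J) : set (nat -> X) :=
  match j with
  | inl (existT d A, p, n) =>
      if (A != fset0) && (mnm0 \notin A)
      then [set u | return_set T A (B p) (W n) (prefix_tuple d.+1 u)]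
      else setT
  | inr p => [set u | exists i, B p (u i)]
  end.
pose F k := if @choice.unpickle J k is Some j then O j else setT.
have [|u Fu] := @baire_sequences R X dist d0 dC dT dN F.
  move=> k x n e e_gt0.
  have triv : exists y m r, [/\ 0 < r,
      (forall i, (i < n)%N -> dist (x i) (y i) < e) &
      forall z, (forall i, (i < m)%N -> dist (y i) (z i) < r) ->
        [set: nat -> X] z].
    by exists x, 0%N, 1; split=> // i _; rewrite distxx.
  rewrite /F; case: (@choice.unpickle J k) => [[[[[d A] p] q]|p]|] //=.
  - case: ifP => // /andP[A0 A0'].
    have [Bo B0] := BP p; have [Wo W0] := WP q.
    have xe : nbhs (prefix_tuple d.+1 x : {ptws 'I_d.+1 -> X})
        [set v | forall i : 'I_d.+1, dist (x i) (v i) < e].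
      by apply/(nbhs_ptws_dist dN); exists e.
    have [v [xv vA]] := return_set_dense (crit d.+1 isT) A0 A0' Bo B0
      (open_nbhs_nbhs (conj Wo W0)) xe.
    have vo : nbhs (v : {ptws 'I_d.+1 -> X}) (return_set T A (B p) (W q)).
      by apply: open_nbhs_nbhs; split=> //; exact: return_set_open.
    have [r r_gt0 rA] := (nbhs_ptws_dist dN _ _).1 vo.
    (* The first [d.+1] coordinates are replaced by those of [v]; the others keep the values of
       [x]. *)
    pose y i := if insub i is Some i' then v i' else x i.
    have yv (i : 'I_d.+1) : y i = v i by rewrite /y valK.
    exists y, d.+1, r; split=> // [i _|z yz].
      rewrite /y; case: insubP => [i' _ <-|_]; first exact: xv.
      by rewrite distxx.
    by apply: rA => i; rewrite /= -yv; exact: yz.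
  - have [Bo [b Bb]] := BP p.
    have [r r_gt0 rB] := (dN b _).1 (open_nbhs_nbhs (conj Bo Bb)).
    exists (fun i => if i == n then b else x i), n.+1, r; split=> //.
      by move=> i i_n; rewrite ltn_eqF // distxx.
    move=> z /(_ n (ltnSn n)); rewrite eqxx => bz.
    by exists n; exact: rB.
exists u; split.
  move=> V V0 Vo; have [p pV] := Bsub V Vo V0.
  have := Fu (choice.pickle (inr p : J)).
  by rewrite /F choice.pickleK => -[i /pV Vi]; exists (u i); split=> //; exists i.
move=> d; apply: (generic_tuple_countable Bsub Wsub) => A p n A0 A0'.
have := Fu (choice.pickle (inl (existT _ d A, p, n) : J)).
by rewrite /F choice.pickleK /O A0 A0'.
Qed.

End GenericExistence.

Unset Implicit Arguments.

(* X = {0} must be excluded: it has no hypercyclic algebra, yet satisfies the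
   criterion. *)
Theorem theorem2p1 (R : realType) (X : fAlgebraType R)
    (X_neq0 : exists x : X, x != 0)
    (X_sep : separable X) (X_comm : commutative (@amul _ X))
    (T : {linear X -> X}) (T_cont : continuous T) :
  (forall d : nat, (1 <= d)%N -> criterion T d ->
    residual [set u : {ptws 'I_d -> X} |
                hypercyclic_algebra T (generated_algebra u)]) /\
  ((forall d : nat, (1 <= d)%N -> criterion T d) ->
    exists S : set X,
      [/\ hypercyclic_algebra T S, dense S & ~ finitely_generated S]).
Proof.
split=> [d d_gt0 crit|crit].
  have [G Gd Ggen] := generic_tuple_residual T_cont X_sep crit.
  exists G => // u /Ggen; apply: generic_hypercyclic_algebra => //.
  exact: criterion_transitive crit.
have [u [u_dense u_gen]] := dense_generic_sequence T_cont X_sep crit.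
have trans := @criterion_transitive R X T 1 isT (crit 1%N isT).
exists (infinite_algebra u); split.
- exact: infinite_algebra_hypercyclic.
- move=> V V0 Vo; have [x [Vx [i _ ux]]] := u_dense V V0 Vo.
  by exists x; split=> //; rewrite -ux; exact: infinite_algebra_gen.
- exact: infinite_algebra_not_fg.
Qed.
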